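(* $$\frac{32}{2G+5}=\mathrm{CF}\left[3n^2+11n+9,\,-2n(n+2)^3\right],$$ where $G$ is Catalan's constant.
   Context: For sequences $(a_n)_{n\ge0}$, $(b_n)_{n\ge1}$, $\mathrm{CF}[a_n,b_n]$ denotes the continued fraction $a_0+\cfrac{b_1}{a_1+\cfrac{b_2}{a_2+\ddots}}$, whose value is $\lim_{n\to\infty}A_n/B_n$, where $A_0=1$, $A_1=a_0$, $B_0=0$, $B_1=1$, and $A_{n+1}=a_nA_n+b_nA_{n-1}$, $B_{n+1}=a_nB_n+b_nB_{n-1}$ for $n\ge1$. Catalan's constant is $G=\sum_{k=0}^\infty \frac{(-1)^k}{(2k+1)^2}$. *)

(* Defs.v *)
From Stdlib Require Import Reals.
From Coquelicot Require Import Coquelicot.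
Open Scope R_scope.

(* The numerators and denominators are indexed so that the n-th convergent
   truncates the fraction just before b n / (a n + ...); the value b 0 is never
   used. *)
Fixpoint cf_num (a b : nat -> R) (n : nat) : R :=
  match n with
  | O => 1
  | S O => a O
  | S (S k as m) => a m * cf_num a b m + b m * cf_num a b k
  end.

Fixpoint cf_den (a b : nat -> R) (n : nat) : R :=
  match n with
  | O => 0
  | S O => 1
  | S (S k as m) => a m * cf_den a b m + b m * cf_den a b k
  end.

(* Division on R is total, and the denominator of index 0 is always 0, so the
   convergents are required to be genuine quotients from some index on. *)
Definition is_CF (a b : nat -> R) (v : R) : Prop :=
  eventually (fun n => cf_den a b n <> 0) /\
  is_lim_seq (fun n => cf_num a b n / cf_den a b n) v.

Definition Catalan : R := Series (fun k => (-1) ^ k / (2 * INR k + 1) ^ 2).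

(* Main.v *)
(* Put [p_j = binomial (2j) j / 4^j] and [lam = lim j p_j^2]. The sums
   [S_n = sum_j p_j^2 / (2j-1)^2 * n! (2j)! / (n+2j+1)!] are positive and bounded
   by [S_0], and by creative telescoping [(n+2)!^2 S_n] satisfies the three-term
   recurrence of the continued fraction. By partial fractions the initial values
   [S_0] and [S_1] reduce to sums that telescope and to
   [sum_j p_j^2 / (2j+1) = 4 lam G], so that
   [(n+2)!^2 S_n = 2 lam ((2G+5) A_n - 32 B_n)]. As [B_n / (n+2)!^2] tends to
   infinity, [A_n / B_n] tends to [32 / (2G+5)].

   For Catalan's constant, let
   [u_k = sum_j p_j binomial (2j) (j-k) / (4^j (2j+1))]. The terms of [u_k + u_{k+1}]
   telescope in [j], which gives [u_k + u_{k+1} = 4 lam / (2k+1)^2]; since [u_k]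
   tends to 0, [u_0] is the alternating sum of these values. *)

Require Import Defs.
From Stdlib Require Import Reals Factorial Lra Lia.
From Coquelicot Require Import Coquelicot.
Open Scope R_scope.

(** * Telescoping series and limits by domination *)

Lemma is_series_lim_seq (u : nat -> R) (l : R) :
  is_series u l <-> is_lim_seq (sum_n u) l.
Proof. reflexivity. Qed.

Lemma is_series_telescope (u T : nat -> R) (l : R) :
  (forall j, u j = T (S j) - T j) -> T O = 0 -> is_lim_seq T l ->
  is_series u l.
Proof.
  intros Hu H0 HT.
  (* [sum_n u n] includes the term of index [n], so it equals [T (S n)]. *)
  apply is_series_lim_seq, is_lim_seq_ext with (fun n => T (S n)).
  - intros n; induction n as [|n IH].
    + rewrite sum_O, Hu, H0; ring.
    + rewrite sum_Sn, <- IH, Hu; unfold plus; simpl; ring.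
  - now apply -> is_lim_seq_incr_1.
Qed.

Lemma is_lim_seq_le_0 (u v : nat -> R) :
  (forall n, Rabs (u n) <= v n) -> is_lim_seq v 0 -> is_lim_seq u 0.
Proof.
  intros Huv Hv; apply is_lim_seq_abs_0.
  apply is_lim_seq_le_le with (fun _ => 0) v; [|apply is_lim_seq_const|exact Hv].
  intros n; split; [apply Rabs_pos|apply Huv].
Qed.

(** * Central binomial coefficients *)

(* [wallis n] is [binomial (2n) n / 4^n]. *)
Fixpoint wallis (n : nat) : R :=
  match n with
  | O => 1
  | S m => wallis m * ((2 * INR m + 1) / (2 * INR m + 2))
  end.

Lemma wallis_S (n : nat) :
  wallis (S n) = wallis n * ((2 * INR n + 1) / (2 * INR n + 2)).
Proof. reflexivity. Qed.

Lemma wallis_pos (n : nat) : 0 < wallis n.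
Proof.
  induction n as [|n IH]; [simpl; lra|].
  rewrite wallis_S; pose proof (pos_INR n).
  apply Rmult_lt_0_compat, Rdiv_lt_0_compat; lra.
Qed.

(** The left side starts at 1 and decreases with [n]. *)
Lemma wallis_sq_upper (n : nat) : (2 * INR n + 1) * wallis n ^ 2 <= 1.
Proof.
  induction n as [|n IH]; [simpl; lra|].
  apply Rle_trans with (2 := IH).
  rewrite wallis_S, S_INR; pose proof (pos_INR n) as Hn.
  pose proof (pow2_ge_0 (wallis n)) as Hw.
  replace ((2 * (INR n + 1) + 1) * (wallis n * ((2 * INR n + 1) / (2 * INR n + 2))) ^ 2)
    with ((2 * INR n + 1) * wallis n ^ 2
          - wallis n ^ 2 * ((2 * INR n + 1) / (2 * INR n + 2) ^ 2)) by (field; lra).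
  assert (0 <= (2 * INR n + 1) / (2 * INR n + 2) ^ 2)
    by (apply Rlt_le, Rdiv_lt_0_compat; nra).
  nra.
Qed.

(** This rests on (2n+1)^2 / (4(n+1)) = n + 1 / (4(n+1)). *)
Lemma wallis_sq_incr (n : nat) :
  INR n * wallis n ^ 2 <= INR (S n) * wallis (S n) ^ 2.
Proof.
  rewrite wallis_S, S_INR; pose proof (pos_INR n) as Hn.
  pose proof (pow2_ge_0 (wallis n)) as Hw.
  replace ((INR n + 1) * (wallis n * ((2 * INR n + 1) / (2 * INR n + 2))) ^ 2)
    with (INR n * wallis n ^ 2 + wallis n ^ 2 * / (4 * (INR n + 1))) by (field; lra).
  assert (0 < / (4 * (INR n + 1))) by (apply Rinv_0_lt_compat; lra).
  nra.
Qed.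

(* Wallis' formula gives [lam = 1 / PI]; only positivity is needed. *)
Lemma wallis_lim :
  exists lam, 0 < lam /\ is_lim_seq (fun n => INR n * wallis n ^ 2) lam.
Proof.
  assert (Hub : forall n, INR n * wallis n ^ 2 <= 1).
  { intros n; pose proof (wallis_sq_upper n); pose proof (pos_INR n).
    pose proof (pow2_ge_0 (wallis n)); nra. }
  destruct (ex_finite_lim_seq_incr _ 1 wallis_sq_incr Hub) as [lam Hlam].
  exists lam; split; [|exact Hlam].
  (* 1/4 is the value at [n = 1]; the value at 0 is 0 and would not give positivity. *)
  apply Rlt_le_trans with (1 / 4); [lra|].
  pose proof (is_lim_seq_incr_compare _ _ Hlam wallis_sq_incr 1) as H.
  simpl in H; lra.
Qed.

Lemma wallis_sq_lim0 : is_lim_seq (fun n => wallis n ^ 2) 0.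
Proof.
  apply is_lim_seq_le_0 with (fun n => / (INR n + 1)).
  - intros n; rewrite Rabs_pos_eq by apply pow2_ge_0.
    pose proof (wallis_sq_upper n); pose proof (pos_INR n) as Hn.
    pose proof (pow2_ge_0 (wallis n)).
    apply Rmult_le_reg_r with (INR n + 1); [lra|].
    rewrite Rinv_l by lra; nra.
  - apply is_lim_seq_ext with (fun n => / INR (S n)).
    { intros n; now rewrite S_INR. }
    apply (is_lim_seq_incr_1 (fun n => / INR n)).
    apply (is_lim_seq_inv _ p_infty); [apply is_lim_seq_INR|discriminate].
Qed.

(** The subtraction is real, so the value at 0 is -1: an odd integer stays at distance at least 1
    from 0. *)
Lemma two_INR_sub1_ge1 (n : nat) : 1 <= Rabs (2 * INR n - 1).
Proof.
  destruct n as [|n].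
  - simpl; rewrite Rabs_left; lra.
  - rewrite S_INR; pose proof (pos_INR n); rewrite Rabs_pos_eq; lra.
Qed.

Lemma two_INR_sub1_neq0 (n : nat) : 2 * INR n - 1 <> 0.
Proof.
  intros H; pose proof (two_INR_sub1_ge1 n) as H1; rewrite H, Rabs_R0 in H1; lra.
Qed.

Lemma Rabs_inv_two_INR_sub1 (n : nat) : Rabs (/ (2 * INR n - 1)) <= 1.
Proof.
  pose proof (two_INR_sub1_ge1 n) as H.
  rewrite Rabs_inv; apply Rmult_le_reg_r with (Rabs (2 * INR n - 1)); [lra|].
  rewrite Rinv_l; lra.
Qed.

Lemma wallis_sq_div_lim0 :
  is_lim_seq (fun n => wallis n ^ 2 / (2 * INR n - 1)) 0.
Proof.
  apply is_lim_seq_le_0 with (2 := wallis_sq_lim0); intros n.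
  pose proof (Rabs_inv_two_INR_sub1 n); pose proof (pow2_ge_0 (wallis n)).
  unfold Rdiv; rewrite Rabs_mult, (Rabs_pos_eq (_ ^ 2)) by apply pow2_ge_0.
  nra.
Qed.

Lemma wallis_sq_div2_lim0 :
  is_lim_seq (fun n => wallis n ^ 2 / (2 * INR n - 1) ^ 2) 0.
Proof.
  apply is_lim_seq_le_0 with (fun n => Rabs (wallis n ^ 2 / (2 * INR n - 1))).
  - intros n; pose proof (Rabs_inv_two_INR_sub1 n).
    replace (wallis n ^ 2 / (2 * INR n - 1) ^ 2)
      with (wallis n ^ 2 / (2 * INR n - 1) * / (2 * INR n - 1))
      by (field; apply two_INR_sub1_neq0).
    rewrite Rabs_mult.
    pose proof (Rabs_pos (wallis n ^ 2 / (2 * INR n - 1))); nra.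
  - apply is_lim_seq_abs_0 with (u := fun n => wallis n ^ 2 / (2 * INR n - 1)).
    apply wallis_sq_div_lim0.
Qed.

(** * Telescoping series in the squares p_j^2 *)

Section WallisSeries.

Variable lam : R.
Hypothesis lam_lim : is_lim_seq (fun n => INR n * wallis n ^ 2) lam.

Lemma series_wallis_plus2 :
  is_series (fun j => wallis j ^ 2 / (2 * INR j + 2)) (2 * lam).
Proof.
  apply is_series_telescope with (fun j => 2 * (INR j * wallis j ^ 2)).
  - intros j; rewrite wallis_S, S_INR; pose proof (pos_INR j); field; lra.
  - simpl; ring.
  - now apply (is_lim_seq_scal_l _ 2 lam).
Qed.

Lemma wallis_minus1_lim :
  is_lim_seq (fun j => 4 * INR j ^ 2 * wallis j ^ 2 / (2 * INR j - 1)) (2 * lam).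
Proof.
  (* Division with remainder: 4j^2 / (2j-1) = 2j + 1 + 1 / (2j-1). *)
  apply is_lim_seq_ext with
    (fun n => 2 * (INR n * wallis n ^ 2)
              + (wallis n ^ 2 + wallis n ^ 2 / (2 * INR n - 1))).
  - intros n; field; apply two_INR_sub1_neq0.
  - replace (2 * lam) with (2 * lam + (0 + 0)) by ring.
    apply is_lim_seq_plus'.
    + now apply (is_lim_seq_scal_l _ 2 lam).
    + apply is_lim_seq_plus'; [apply wallis_sq_lim0|apply wallis_sq_div_lim0].
Qed.

Lemma series_wallis_minus1 :
  is_series (fun j => - (wallis j ^ 2 / (2 * INR j - 1))) (2 * lam).
Proof.
  apply is_series_telescope with (3 := wallis_minus1_lim).
  - intros j; rewrite wallis_S.
    pose proof (two_INR_sub1_neq0 j); pose proof (two_INR_sub1_neq0 (S j)).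
    rewrite S_INR in *; pose proof (pos_INR j); field; repeat split; lra.
  - simpl; field; lra.
Qed.

(** As 4(j+1)^2 p_{j+1}^2 = (2j+1)^2 p_j^2, shifting the antidifference cancels its denominators.
    Its two parts are combined so that the differences leave no 1 / (2j-1) term. *)
Lemma series_wallis_minus1_sq :
  is_series (fun j => wallis j ^ 2 / (2 * INR j - 1) ^ 2) (4 * lam).
Proof.
  apply is_series_telescope with
    (fun j => 2 * (4 * INR j ^ 2 * wallis j ^ 2 / (2 * INR j - 1))
              - 4 * INR j ^ 2 * wallis j ^ 2 / (2 * INR j - 1) ^ 2).
  - intros j; rewrite wallis_S.
    pose proof (two_INR_sub1_neq0 j); pose proof (two_INR_sub1_neq0 (S j)).
    rewrite S_INR in *; pose proof (pos_INR j); field; repeat split; lra.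
  - simpl; field; lra.
  - replace (4 * lam) with (2 * (2 * lam) - (0 + (2 * 0 + 0))) by ring.
    apply is_lim_seq_minus'.
    + apply (is_lim_seq_scal_l _ 2 (2 * lam)), wallis_minus1_lim.
    + apply is_lim_seq_ext with
        (fun n => wallis n ^ 2 + (2 * (wallis n ^ 2 / (2 * INR n - 1))
                  + wallis n ^ 2 / (2 * INR n - 1) ^ 2)).
      { intros n; field; apply two_INR_sub1_neq0. }
      apply is_lim_seq_plus'; [apply wallis_sq_lim0|].
      apply is_lim_seq_plus'; [|apply wallis_sq_div2_lim0].
      apply (is_lim_seq_scal_l _ 2 0), wallis_sq_div_lim0.
Qed.

End WallisSeries.

(** * Catalan's constant *)

(* [shifted_wallis n k] is [binomial (2n) (n-k) / 4^n]. *)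
Fixpoint shifted_wallis (n k : nat) : R :=
  match k with
  | O => wallis n
  | S i => shifted_wallis n i * ((INR n - INR i) / (INR n + INR i + 1))
  end.

Lemma shifted_wallis_S (n k : nat) :
  shifted_wallis n (S k)
  = shifted_wallis n k * ((INR n - INR k) / (INR n + INR k + 1)).
Proof. reflexivity. Qed.

Lemma shifted_wallis_eq0 (n k : nat) : (n < k)%nat -> shifted_wallis n k = 0.
Proof.
  induction k as [|k IH]; intros Hk; [lia|].
  rewrite shifted_wallis_S.
  destruct (Nat.eq_dec n k) as [->|Hne].
  - unfold Rdiv; ring.
  - rewrite IH by lia; ring.
Qed.

Lemma shifted_wallis_bounds (n k : nat) :
  0 <= shifted_wallis n k <= wallis n.
Proof.
  induction k as [|k IH].
  - simpl; pose proof (wallis_pos n); lra.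
  - destruct (Nat.lt_ge_cases n k) as [Hk|Hk].
    + rewrite shifted_wallis_eq0 by lia; pose proof (wallis_pos n); lra.
    + rewrite shifted_wallis_S; apply le_INR in Hk; pose proof (pos_INR k).
      assert (0 <= (INR n - INR k) / (INR n + INR k + 1) <= 1).
      { split; [apply Rdiv_le_0_compat; lra|].
        apply Rmult_le_reg_r with (INR n + INR k + 1); [lra|].
        unfold Rdiv; rewrite Rmult_assoc, Rinv_l; lra. }
      nra.
Qed.

(** The factor n+1-k stays on the left so that the ratio of neighbouring binomials also covers
    [k = n + 1], where both sides vanish. *)
Lemma shifted_wallis_succ (n k : nat) :
  (INR n + 1 - INR k) * shifted_wallis (S n) k
  = shifted_wallis n k
    * ((2 * INR n + 1) * (INR n + 1) / (2 * (INR n + INR k + 1))).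
Proof.
  pose proof (pos_INR n) as Hn.
  induction k as [|k IH].
  - simpl; field; lra.
  - pose proof (pos_INR k); rewrite 2!shifted_wallis_S, 2!S_INR.
    transitivity ((INR n + 1 - INR k) * shifted_wallis (S n) k
                  * ((INR n - INR k) / (INR n + INR k + 2))).
    + field; lra.
    + rewrite IH; field; lra.
Qed.

Section CatalanSeries.

Variable lam : R.
Hypothesis lam_pos : 0 < lam.
Hypothesis lam_lim : is_lim_seq (fun n => INR n * wallis n ^ 2) lam.

Lemma wallis_shifted_lim0 (k : nat) :
  is_lim_seq (fun n => wallis n * shifted_wallis n k) 0.
Proof.
  apply is_lim_seq_le_0 with (2 := wallis_sq_lim0); intros n.
  pose proof (shifted_wallis_bounds n k); pose proof (wallis_pos n).
  rewrite Rabs_pos_eq; nra.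
Qed.

Lemma wallis_shifted_lim (k : nat) :
  is_lim_seq (fun n => INR n * (wallis n * shifted_wallis n k)) lam.
Proof.
  induction k as [|k IH].
  - apply is_lim_seq_ext with (2 := lam_lim); intros n; simpl; ring.
  (* The factor (n-k) / (n+k+1) is 1 - (2k+1) / (n+k+1), so passing from [k] to [S k] changes the
     sequence by a null sequence. *)
  - apply is_lim_seq_ext with
      (fun n => INR n * (wallis n * shifted_wallis n k)
                - (2 * INR k + 1) * (INR n / (INR n + INR k + 1)
                   * (wallis n * shifted_wallis n k))).
    { intros n; rewrite shifted_wallis_S; pose proof (pos_INR n); pose proof (pos_INR k).
      field; lra. }
    replace lam with (lam - (2 * INR k + 1) * 0) by ring.
    apply is_lim_seq_minus'; [exact IH|].
    apply (is_lim_seq_scal_l _ (2 * INR k + 1) 0).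
    apply is_lim_seq_le_0 with (2 := wallis_shifted_lim0 k); intros n.
    pose proof (pos_INR n); pose proof (pos_INR k).
    pose proof (shifted_wallis_bounds n k); pose proof (wallis_pos n).
    assert (0 <= wallis n * shifted_wallis n k) by nra.
    assert (0 <= INR n / (INR n + INR k + 1) <= 1).
    { split; [apply Rdiv_le_0_compat; lra|].
      apply Rmult_le_reg_r with (INR n + INR k + 1); [lra|].
      unfold Rdiv; rewrite Rmult_assoc, Rinv_l; lra. }
    rewrite Rabs_pos_eq; nra.
Qed.

Lemma series_wallis_shifted_sum (k : nat) :
  is_series (fun j => wallis j * shifted_wallis j k / (INR j + INR k + 1))
            (4 * lam / (2 * INR k + 1) ^ 2).
Proof.
  pose proof (pos_INR k) as Hk.
  (* In the difference the numerator (2j+1)^2 - 4(j-k)(j+k+1) collapses to (2k+1)^2, the source of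
     the odd squares in Catalan's series. *)
  apply is_series_telescope with
    (fun j => 4 / (2 * INR k + 1) ^ 2
              * (wallis j * ((INR j - INR k) * shifted_wallis j k))).
  - intros j; pose proof (pos_INR j).
    replace (INR (S j) - INR k) with (INR j + 1 - INR k) by (rewrite S_INR; ring).
    rewrite shifted_wallis_succ, wallis_S; field; lra.
  - destruct k as [|k]; [simpl; ring|].
    rewrite shifted_wallis_eq0 by lia; ring.
  - apply is_lim_seq_ext with
      (fun j => 4 / (2 * INR k + 1) ^ 2
         * (INR j * (wallis j * shifted_wallis j k)
            - INR k * (wallis j * shifted_wallis j k))).
    { intros j; field; lra. }
    replace (4 * lam / (2 * INR k + 1) ^ 2)
      with (4 / (2 * INR k + 1) ^ 2 * (lam - INR k * 0)) by (field; lra).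
    apply (is_lim_seq_scal_l _ _ (lam - INR k * 0)).
    apply is_lim_seq_minus'; [apply wallis_shifted_lim|].
    apply (is_lim_seq_scal_l _ (INR k) 0), wallis_shifted_lim0.
Qed.

(** Only convergence is available here, by comparison with [series_wallis_plus2]; the value follows
    once this series is recognised as u_0. *)
Lemma ex_series_wallis_plus1 :
  ex_series (fun j => wallis j ^ 2 / (2 * INR j + 1)).
Proof.
  apply @ex_series_le with (fun j => 2 * (wallis j ^ 2 / (2 * INR j + 2))).
  - intros j; pose proof (pos_INR j); pose proof (pow2_ge_0 (wallis j)).
    unfold norm; simpl; unfold abs; simpl.
    rewrite Rabs_pos_eq by (apply Rdiv_le_0_compat; simpl in *; lra).
    change (wallis j * (wallis j * 1)) with (wallis j ^ 2).
    replace (2 * (wallis j ^ 2 / (2 * INR j + 2)))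
      with (wallis j ^ 2 * / (INR j + 1)) by (field; lra).
    apply Rmult_le_compat_l; [assumption|]; apply Rinv_le_contravar; lra.
  - apply (@ex_series_scal_l R_AbsRing R_NormedModule 2); exists (2 * lam); now apply series_wallis_plus2.
Qed.

(** The j-th term of u_k. *)
Definition shifted_term (k j : nat) : R :=
  wallis j * shifted_wallis j k / (2 * INR j + 1).

(** Since 1 + (j-k) / (j+k+1) = (2j+1) / (j+k+1), the denominator 2j+1 cancels and a telescoping
    summand remains. *)
Lemma shifted_term_add (k j : nat) :
  shifted_term k j + shifted_term (S k) j
  = wallis j * shifted_wallis j k / (INR j + INR k + 1).
Proof.
  unfold shifted_term; rewrite shifted_wallis_S.
  pose proof (pos_INR j); pose proof (pos_INR k); field; lra.
Qed.

Lemma shifted_term_bounds (k j : nat) :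
  0 <= shifted_term k j <= shifted_term 0 j.
Proof.
  unfold shifted_term; pose proof (pos_INR j).
  pose proof (shifted_wallis_bounds j k); pose proof (wallis_pos j).
  change (shifted_wallis j 0) with (wallis j).
  assert (0 < / (2 * INR j + 1)) by (apply Rinv_0_lt_compat; lra).
  unfold Rdiv; split; [repeat apply Rmult_le_pos; lra|].
  apply Rmult_le_compat_r; [lra|]; nra.
Qed.

Lemma shifted_term_eq0 (k j : nat) : (j < k)%nat -> shifted_term k j = 0.
Proof.
  intros H; unfold shifted_term; rewrite shifted_wallis_eq0 by exact H.
  unfold Rdiv; ring.
Qed.

(** The terms of u_{k+1} vanish for j <= k and are dominated by those of u_0 afterwards. This
    compares u_{k+1} with a remainder of u_0. *)
Lemma sum_shifted_term_le (k i : nat) :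
  sum_n (shifted_term (S k)) (i + k)
  <= sum_n (shifted_term 0) (i + k) - sum_n (shifted_term 0) k.
Proof.
  induction i as [|i IH]; simpl.
  - rewrite Rminus_diag.
    rewrite (sum_n_ext_loc _ (fun _ => 0)).
    + rewrite sum_n_const; lra.
    + intros n Hn; apply shifted_term_eq0; lia.
  - rewrite 2!sum_Sn; unfold plus; simpl.
    pose proof (shifted_term_bounds (S k) (S (i + k))); lra.
Qed.

Definition shifted_sum (k : nat) : R := Series (shifted_term k).

Lemma shifted_sum_correct (k : nat) : is_series (shifted_term k) (shifted_sum k).
Proof.
  apply Series_correct, @ex_series_le with (shifted_term 0).
  - intros j; pose proof (shifted_term_bounds k j).
    unfold norm; simpl; unfold abs; simpl; rewrite Rabs_pos_eq; lra.
  - apply ex_series_ext with (2 := ex_series_wallis_plus1); intros j.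
    unfold shifted_term; simpl; unfold Rdiv; ring.
Qed.

Lemma shifted_sum_succ (k : nat) :
  shifted_sum k + shifted_sum (S k) = 4 * lam / (2 * INR k + 1) ^ 2.
Proof.
  rewrite <- (is_series_unique _ _ (series_wallis_shifted_sum k)).
  symmetry; apply is_series_unique.
  apply is_series_ext with (fun j => plus (shifted_term k j) (shifted_term (S k) j)).
  - intros j; apply shifted_term_add.
  - apply (is_series_plus (shifted_term k)); apply shifted_sum_correct.
Qed.

Lemma shifted_sum_lim0 : is_lim_seq (fun k => shifted_sum (S k)) 0.
Proof.
  apply is_lim_seq_le_0 with (fun k => shifted_sum 0 - sum_n (shifted_term 0) k).
  - intros k.
    assert (H0 : 0 <= shifted_sum (S k)).
    { pose proof (proj1 (is_series_lim_seq _ _) (shifted_sum_correct (S k))) as H.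
      refine (is_lim_seq_le (fun _ => 0) _ 0 _ _ (is_lim_seq_const 0) H).
      intros n; induction n as [|n IH].
      - rewrite sum_O; apply shifted_term_bounds.
      - rewrite sum_Sn; unfold plus; simpl.
        pose proof (shifted_term_bounds (S k) (S n)); lra. }
    rewrite Rabs_pos_eq by exact H0.
    (* With [k] fixed, [i] tends to infinity. *)
    refine (is_lim_seq_le _ _ (Finite _) (Finite _) (sum_shifted_term_le k) _ _).
    + apply (is_lim_seq_incr_n (sum_n (shifted_term (S k)))).
      apply is_series_lim_seq, shifted_sum_correct.
    + apply is_lim_seq_minus'; [|apply is_lim_seq_const].
      apply (is_lim_seq_incr_n (sum_n (shifted_term 0))).
      apply is_series_lim_seq, shifted_sum_correct.
  - replace 0 with (shifted_sum 0 - shifted_sum 0) by ring.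
    apply is_lim_seq_minus'; [apply is_lim_seq_const|].
    apply is_series_lim_seq, shifted_sum_correct.
Qed.

(** The alternating sum of u_k + u_{k+1} telescopes. *)
Lemma sum_catalan (n : nat) :
  4 * lam * sum_n (fun k => (-1) ^ k / (2 * INR k + 1) ^ 2) n
  = shifted_sum 0 + (-1) ^ n * shifted_sum (S n).
Proof.
  induction n as [|n IH].
  - rewrite sum_O; pose proof (shifted_sum_succ 0) as H; simpl in *; lra.
  - rewrite sum_Sn; change plus with Rplus.
    rewrite Rmult_plus_distr_l, IH.
    pose proof (shifted_sum_succ (S n)) as H; pose proof (pos_INR (S n)).
    replace (4 * lam * ((-1) ^ S n / (2 * INR (S n) + 1) ^ 2))
      with ((-1) ^ S n * (4 * lam / (2 * INR (S n) + 1) ^ 2)) by (field; lra).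
    rewrite <- H; change ((-1) ^ S n) with (-1 * (-1) ^ n); ring.
Qed.

Lemma Catalan_shifted_sum : shifted_sum 0 = 4 * lam * Catalan.
Proof.
  assert (H : is_series (fun k => (-1) ^ k / (2 * INR k + 1) ^ 2)
                        (shifted_sum 0 / (4 * lam))).
  { apply is_series_lim_seq, is_lim_seq_ext with
      (fun n => / (4 * lam) * (shifted_sum 0 + (-1) ^ n * shifted_sum (S n))).
    { intros n; rewrite <- sum_catalan; field; lra. }
    replace (shifted_sum 0 / (4 * lam))
      with (/ (4 * lam) * (shifted_sum 0 + 0)) by (field; lra).
    apply (is_lim_seq_scal_l _ _ (shifted_sum 0 + 0)).
    apply is_lim_seq_plus'; [apply is_lim_seq_const|].
    apply is_lim_seq_le_0 with (fun k => Rabs (shifted_sum (S k))).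
    - intros n; rewrite Rabs_mult, pow_1_abs; lra.
    - apply is_lim_seq_abs_0 with (u := fun k => shifted_sum (S k)), shifted_sum_lim0. }
  unfold Catalan; rewrite (is_series_unique _ _ H); field; lra.
Qed.

Lemma series_wallis_plus1 :
  is_series (fun j => wallis j ^ 2 / (2 * INR j + 1)) (4 * lam * Catalan).
Proof.
  rewrite <- Catalan_shifted_sum.
  apply is_series_ext with (2 := shifted_sum_correct 0); intros j.
  unfold shifted_term; simpl; unfold Rdiv; ring.
Qed.

End CatalanSeries.

(** * The minimal solution of the recurrence *)

(* [beta_int n j] is the Euler integral of [x^(2j) (1-x)^n] over [[0,1]], that
   is [n! (2j)! / (n+2j+1)!]. *)
Fixpoint beta_int (n j : nat) : R :=
  match n with
  | O => / (2 * INR j + 1)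
  | S m => beta_int m j * ((INR m + 1) / (INR m + 2 * INR j + 2))
  end.

Lemma beta_int_S (n j : nat) :
  beta_int (S n) j = beta_int n j * ((INR n + 1) / (INR n + 2 * INR j + 2)).
Proof. reflexivity. Qed.

Lemma beta_int_succ (n j : nat) :
  beta_int n (S j)
  = beta_int n j * ((2 * INR j + 1) * (2 * INR j + 2)
                    / ((INR n + 2 * INR j + 2) * (INR n + 2 * INR j + 3))).
Proof.
  pose proof (pos_INR j) as Hj.
  induction n as [|n IH].
  - unfold beta_int; rewrite S_INR; simpl (INR 0); field; lra.
  - pose proof (pos_INR n); rewrite 2!beta_int_S, IH, 2!S_INR; field; lra.
Qed.

Lemma beta_int_bounds (n j : nat) : 0 <= beta_int n j <= / (2 * INR j + 1).
Proof.
  pose proof (pos_INR j) as Hj.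
  assert (0 < / (2 * INR j + 1)) by (apply Rinv_0_lt_compat; lra).
  induction n as [|n IH]; [simpl; lra|].
  rewrite beta_int_S; pose proof (pos_INR n).
  assert (0 <= (INR n + 1) / (INR n + 2 * INR j + 2) <= 1).
  { split; [apply Rdiv_le_0_compat; lra|].
    apply Rmult_le_reg_r with (INR n + 2 * INR j + 2); [lra|].
    unfold Rdiv; rewrite Rmult_assoc, Rinv_l; lra. }
  nra.
Qed.

(** The j-th term of S_n. The weight is the square of the coefficient of x^j in the expansion of
    sqrt(1-x). *)
Definition tail_term (n j : nat) : R :=
  wallis j ^ 2 / (2 * INR j - 1) ^ 2 * beta_int n j.

Definition tail (n : nat) : R := Series (tail_term n).

Lemma wallis_minus1_sq_ge0 (j : nat) : 0 <= wallis j ^ 2 / (2 * INR j - 1) ^ 2.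
Proof.
  apply Rdiv_le_0_compat; [apply pow2_ge_0|].
  pose proof (two_INR_sub1_neq0 j); apply pow2_gt_0; assumption.
Qed.

Lemma tail_term_bounds (n j : nat) :
  0 <= tail_term n j <= wallis j ^ 2 / (2 * INR j - 1) ^ 2 / (2 * INR j + 1).
Proof.
  unfold tail_term; pose proof (beta_int_bounds n j).
  pose proof (wallis_minus1_sq_ge0 j); unfold Rdiv at 2; split.
  - apply Rmult_le_pos; lra.
  - apply Rmult_le_compat_l; lra.
Qed.

(** * Initial values, bounds and recurrence of S_n *)

Section Tail.

Variable lam : R.
Hypothesis lam_pos : 0 < lam.
Hypothesis lam_lim : is_lim_seq (fun n => INR n * wallis n ^ 2) lam.

(** With x = 2j-1, the partial fractions are 1 / (x^2 (x+2)) = 1 / (2x^2) - 1 / (4x) + 1 / (4(x+2));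
    the last one brings in Catalan's constant. *)
Lemma tail0_series :
  is_series (fun j => wallis j ^ 2 / (2 * INR j - 1) ^ 2 / (2 * INR j + 1))
            (lam * (2 * Catalan + 5) / 2).
Proof.
  pose proof (is_series_scal_l (1 / 2) _ _ (series_wallis_minus1_sq lam lam_lim)) as H1.
  pose proof (is_series_scal_l (1 / 4) _ _ (series_wallis_minus1 lam lam_lim)) as H2.
  pose proof (is_series_scal_l (1 / 4) _ _ (series_wallis_plus1 lam lam_pos lam_lim)) as H3.
  pose proof (is_series_plus _ _ _ _ (is_series_plus _ _ _ _ H1 H2) H3) as H.
  match type of H with is_series _ ?l =>
    replace (lam * (2 * Catalan + 5) / 2) with l by
      (unfold plus, scal; simpl; unfold mult; simpl; field) end.
  apply is_series_ext with (2 := H); intros j.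
  unfold plus, scal; simpl; unfold mult; simpl.
  pose proof (two_INR_sub1_neq0 j); pose proof (pos_INR j); field; lra.
Qed.

(** This series is S_0 - S_1, because 1 / ((2j+1)(2j+2)) = 1 / (2j+1) - 1 / (2j+2). With x = 2j-1, 1
    / (x^2 (x+3)) = 1 / (3x^2) - 1 / (9x) + 1 / (9(x+3)). *)
Lemma tail01_series :
  is_series (fun j => wallis j ^ 2 / (2 * INR j - 1) ^ 2 / (2 * INR j + 2))
            (16 / 9 * lam).
Proof.
  pose proof (is_series_scal_l (1 / 3) _ _ (series_wallis_minus1_sq lam lam_lim)) as H1.
  pose proof (is_series_scal_l (1 / 9) _ _ (series_wallis_minus1 lam lam_lim)) as H2.
  pose proof (is_series_scal_l (1 / 9) _ _ (series_wallis_plus2 lam lam_lim)) as H3.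
  pose proof (is_series_plus _ _ _ _ (is_series_plus _ _ _ _ H1 H2) H3) as H.
  match type of H with is_series _ ?l =>
    replace (16 / 9 * lam) with l by
      (unfold plus, scal; simpl; unfold mult; simpl; field) end.
  apply is_series_ext with (2 := H); intros j.
  unfold plus, scal; simpl; unfold mult; simpl.
  pose proof (two_INR_sub1_neq0 j); pose proof (pos_INR j); field; lra.
Qed.

Lemma ex_series_tail (n : nat) : ex_series (tail_term n).
Proof.
  apply @ex_series_le with (2 := ex_intro _ _ tail0_series).
  intros j; pose proof (tail_term_bounds n j).
  unfold norm; simpl; unfold abs; simpl; rewrite Rabs_pos_eq; simpl in *; lra.
Qed.

Lemma tail_correct (n : nat) : is_series (tail_term n) (tail n).
Proof. apply Series_correct, ex_series_tail. Qed.

Lemma tail_0 : tail 0 = lam * (2 * Catalan + 5) / 2.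
Proof. apply is_series_unique, tail0_series. Qed.

Lemma tail_1 : tail 1 = tail 0 - 16 / 9 * lam.
Proof.
  pose proof (is_series_minus _ _ _ _ (tail_correct 0) tail01_series) as H.
  apply is_series_unique, is_series_ext with (2 := H); intros j.
  unfold tail_term, plus, opp; simpl.
  pose proof (two_INR_sub1_neq0 j); pose proof (pos_INR j); field; lra.
Qed.

Lemma tail_bounds (n : nat) : 0 <= tail n <= tail 0.
Proof.
  split.
  - pose proof (proj1 (is_series_lim_seq _ _) (tail_correct n)) as H.
    refine (is_lim_seq_le (fun _ => 0) _ 0 _ _ (is_lim_seq_const 0) H).
    intros N; induction N as [|N IH].
    + rewrite sum_O; apply tail_term_bounds.
    + rewrite sum_Sn; change plus with Rplus.
      pose proof (tail_term_bounds n (S N)); lra.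
  - apply Series_le; [|apply ex_series_tail].
    (* The upper bound there is [tail_term 0 j] up to conversion. *)
    intros j; apply tail_term_bounds.
Qed.

(* Creative telescoping; the certificate is [- 2 (m+1) j * tail_term m j]. *)
Lemma tail_rec (m : nat) :
  (INR m + 4) ^ 2 * tail (S (S m))
  = (3 * INR (S m) ^ 2 + 11 * INR (S m) + 9) * tail (S m)
    - 2 * INR (S m) * (INR (S m) + 2) * tail m.
Proof.
  rewrite S_INR.
  set (c2 := (INR m + 4) ^ 2).
  set (c1 := 3 * (INR m + 1) ^ 2 + 11 * (INR m + 1) + 9).
  set (c0 := 2 * (INR m + 1) * (INR m + 1 + 2)).
  assert (H1 : is_series (fun j => c2 * tail_term (S (S m)) j
                 - c1 * tail_term (S m) j + c0 * tail_term m j)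
               (c2 * tail (S (S m)) - c1 * tail (S m) + c0 * tail m)).
  { pose proof (fun c n => is_series_scal_l c _ _ (tail_correct n)) as Hc.
    exact (is_series_plus _ _ _ _
             (is_series_minus _ _ _ _ (Hc c2 (S (S m))) (Hc c1 (S m))) (Hc c0 m)). }
  assert (H2 : is_series (fun j => c2 * tail_term (S (S m)) j
                 - c1 * tail_term (S m) j + c0 * tail_term m j) 0).
  { apply is_series_telescope with
      (fun j => - (2 * (INR m + 1) * INR j * tail_term m j)).
    - intros j; unfold tail_term, c2, c1, c0.
      rewrite beta_int_succ, 2!beta_int_S, wallis_S.
      pose proof (two_INR_sub1_neq0 j); pose proof (two_INR_sub1_neq0 (S j)).
      rewrite !S_INR in *; pose proof (pos_INR j); pose proof (pos_INR m).
      field; repeat split; lra.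
    - simpl; ring.
    (* The factor j of the certificate is absorbed by the bound 1 / (2j+1) on the Euler integral,
       leaving a multiple of the null weight. *)
    - apply is_lim_seq_le_0 with
        (fun j => (INR m + 1) * (wallis j ^ 2 / (2 * INR j - 1) ^ 2)).
      + intros j; pose proof (tail_term_bounds m j) as Hb.
        pose proof (pos_INR j); pose proof (pos_INR m).
        rewrite Rabs_Ropp, Rabs_pos_eq by (repeat (apply Rmult_le_pos; try lra)).
        replace (2 * (INR m + 1) * INR j * tail_term m j)
          with ((INR m + 1) * (2 * INR j * tail_term m j)) by ring.
        apply Rmult_le_compat_l; [lra|].
        pose proof (wallis_minus1_sq_ge0 j).
        set (w := wallis j ^ 2 / (2 * INR j - 1) ^ 2) in *.
        apply Rle_trans with ((2 * INR j + 1) * (w / (2 * INR j + 1)));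
          [apply Rmult_le_compat; lra|].
        right; field; lra.
      + replace 0 with ((INR m + 1) * 0) by ring.
        apply (is_lim_seq_scal_l _ (INR m + 1) 0), wallis_sq_div2_lim0. }
  pose proof (is_series_unique _ _ H1) as E1.
  rewrite (is_series_unique _ _ H2) in E1; lra.
Qed.

End Tail.

(** * The convergents *)

(** This normalisation absorbs two of the three factors n+2 in [cf_b n]. *)
Definition fact2_sq (n : nat) : R := INR (fact (n + 2)) ^ 2.

Lemma fact2_sq_pos (n : nat) : 0 < fact2_sq n.
Proof. apply pow2_gt_0, INR_fact_neq_0. Qed.

Lemma fact2_sq_S (n : nat) : fact2_sq (S n) = (INR n + 3) ^ 2 * fact2_sq n.
Proof.
  unfold fact2_sq; replace (S n + 2)%nat with (S (n + 2)) by lia.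
  rewrite fact_simpl, mult_INR, S_INR, plus_INR; simpl (INR 2); ring.
Qed.

Definition cf_a (n : nat) : R := 3 * INR n ^ 2 + 11 * INR n + 9.
Definition cf_b (n : nat) : R := - 2 * INR n * (INR n + 2) ^ 3.

(** Both sides satisfy the same three-term recurrence and agree at indices 0 and 1. *)
Lemma cf_tail (lam : R) (n : nat) :
  0 < lam -> is_lim_seq (fun n => INR n * wallis n ^ 2) lam ->
  2 * lam * ((2 * Catalan + 5) * cf_num cf_a cf_b n - 32 * cf_den cf_a cf_b n)
  = fact2_sq n * tail n.
Proof.
  intros Hpos Hlim.
  enough (H : forall m,
    2 * lam * ((2 * Catalan + 5) * cf_num cf_a cf_b m - 32 * cf_den cf_a cf_b m)
    = fact2_sq m * tail m /\
    2 * lam * ((2 * Catalan + 5) * cf_num cf_a cf_b (S m)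
               - 32 * cf_den cf_a cf_b (S m))
    = fact2_sq (S m) * tail (S m)) by apply H.
  clear n; intros m; induction m as [|m [IH0 IH1]].
  - rewrite (tail_1 lam Hpos Hlim), (tail_0 lam Hpos Hlim).
    (* The constant 32 arises at index 1: 3!^2 times 16/9 is 2 times 32. *)
    unfold fact2_sq, cf_a; simpl; split; field.
  - split; [exact IH1|].
    change (cf_num cf_a cf_b (S (S m)))
      with (cf_a (S m) * cf_num cf_a cf_b (S m) + cf_b (S m) * cf_num cf_a cf_b m).
    change (cf_den cf_a cf_b (S (S m)))
      with (cf_a (S m) * cf_den cf_a cf_b (S m) + cf_b (S m) * cf_den cf_a cf_b m).
    transitivity (cf_a (S m) * (fact2_sq (S m) * tail (S m))
                  + cf_b (S m) * (fact2_sq m * tail m)).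
    { rewrite <- IH0, <- IH1; ring. }
    rewrite (fact2_sq_S (S m)).
    replace ((INR (S m) + 3) ^ 2 * fact2_sq (S m) * tail (S (S m)))
      with (fact2_sq (S m) * ((INR m + 4) ^ 2 * tail (S (S m))))
      by (rewrite S_INR; ring).
    rewrite (tail_rec lam Hpos Hlim), (fact2_sq_S m).
    unfold cf_a, cf_b; rewrite S_INR; ring.
Qed.

(** * Growth of the denominators *)

Definition scaled_den (n : nat) : R := cf_den cf_a cf_b n / fact2_sq n.

(** The splitting 3n^2 + 11n + 9 = (n+3)^2 + n + 2n(n+2), taken at [S n], turns the recurrence into
    one for increments with nonnegative coefficients, despite the negative [cf_b]. *)
Lemma scaled_den_rec (n : nat) :
  (INR n + 4) ^ 2 * (scaled_den (S (S n)) - scaled_den (S n))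
  = INR (S n) * scaled_den (S n)
    + 2 * INR (S n) * (INR n + 3) * (scaled_den (S n) - scaled_den n).
Proof.
  unfold scaled_den.
  change (cf_den cf_a cf_b (S (S n)))
    with (cf_a (S n) * cf_den cf_a cf_b (S n) + cf_b (S n) * cf_den cf_a cf_b n).
  rewrite 2!fact2_sq_S; unfold cf_a, cf_b; rewrite S_INR.
  pose proof (fact2_sq_pos n); pose proof (pos_INR n); field; lra.
Qed.

Lemma scaled_den_incr (n : nat) :
  0 <= scaled_den n /\ scaled_den n < scaled_den (S n).
Proof.
  induction n as [|n [IH0 IH1]].
  - unfold scaled_den, fact2_sq; simpl; lra.
  - split; [lra|].
    pose proof (scaled_den_rec n) as H; pose proof (pos_INR n).
    rewrite S_INR in H.
    assert (0 < 2 * (INR n + 1) * (INR n + 3) * (scaled_den (S n) - scaled_den n))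
      by (repeat apply Rmult_lt_0_compat; lra).
    assert (0 <= (INR n + 1) * scaled_den (S n)) by (apply Rmult_le_pos; lra).
    assert (0 < (INR n + 4) ^ 2) by (apply pow2_gt_0; lra).
    nra.
Qed.

(* For [m >= 5], [2 (m+1) (m+3) >= (m+4)^2], so the increments stop decreasing. *)
Lemma scaled_den_convex (n : nat) :
  scaled_den 6 - scaled_den 5
  <= scaled_den (S (n + 5)) - scaled_den (n + 5).
Proof.
  induction n as [|n IH]; [apply Rle_refl|].
  apply Rle_trans with (1 := IH); simpl.
  set (m := (n + 5)%nat).
  assert (Hm : 5 <= INR m) by (unfold m; rewrite plus_INR; simpl; pose proof (pos_INR n); lra).
  pose proof (scaled_den_rec m) as H; rewrite S_INR in H.
  pose proof (scaled_den_incr m) as [H0 H1].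
  assert (0 <= (INR m + 1) * scaled_den (S m)) by (apply Rmult_le_pos; lra).
  (* m^2 - 10 is 2(m+1)(m+3) - (m+4)^2. *)
  assert (0 <= (INR m ^ 2 - 10) * (scaled_den (S m) - scaled_den m))
    by (apply Rmult_le_pos; nra).
  apply Rmult_le_reg_l with ((INR m + 4) ^ 2); [apply pow2_gt_0; lra|].
  rewrite H; lra.
Qed.

(** From index 5 on, the increments are at least a positive constant, so the growth is at least
    linear. *)
Lemma scaled_den_lim : is_lim_seq scaled_den p_infty.
Proof.
  pose proof (scaled_den_incr 5) as [H5 H6].
  apply (is_lim_seq_incr_n scaled_den 5).
  apply is_lim_seq_le_p_loc with (fun n => (scaled_den 6 - scaled_den 5) * INR n).
  - exists O; intros n _; induction n as [|n IH].
    + simpl INR; simpl Nat.add; lra.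
    + rewrite S_INR; pose proof (scaled_den_convex n).
      change (S n + 5)%nat with (S (n + 5)); lra.
  - replace p_infty with (Rbar_mult (scaled_den 6 - scaled_den 5) p_infty).
    + apply is_lim_seq_scal_l, is_lim_seq_INR.
    + apply is_Rbar_mult_unique, is_Rbar_mult_sym, is_Rbar_mult_p_infty_pos.
      simpl; lra.
Qed.

Theorem corollary2p15 :
  is_CF (fun n => 3 * INR n ^ 2 + 11 * INR n + 9)
        (fun n => - 2 * INR n * (INR n + 2) ^ 3)
        (32 / (2 * Catalan + 5)).
Proof.
  change (is_CF cf_a cf_b (32 / (2 * Catalan + 5))).
  destruct wallis_lim as [lam [Hpos Hlim]].
  assert (Hden : forall n, 0 < scaled_den (S n)).
  { intros n; pose proof (scaled_den_incr n); lra. }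
  (* Otherwise S_0 = 0 and S_1 = -16/9 lam would be negative. *)
  assert (HG : 2 * Catalan + 5 <> 0).
  { pose proof (tail_0 lam Hpos Hlim) as E0; pose proof (tail_1 lam Hpos Hlim) as E1.
    pose proof (tail_bounds lam Hpos Hlim 1) as [E2 _].
    intros HG; rewrite HG in E0; nra. }
  assert (Hcf : forall n, cf_den cf_a cf_b n = fact2_sq n * scaled_den n).
  { intros n; unfold scaled_den; pose proof (fact2_sq_pos n); field; lra. }
  split.
  - exists 1%nat; intros n Hn; destruct n as [|n]; [lia|].
    rewrite Hcf; pose proof (Hden n); pose proof (fact2_sq_pos (S n)); nra.
  - apply is_lim_seq_incr_1.
    (* Dividing [cf_tail] by the denominator shows the error of the convergent as a constant times
       [tail / scaled_den], a bounded sequence over one tending to infinity. *)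
    apply is_lim_seq_ext with
      (fun n => 32 / (2 * Catalan + 5)
                + / (2 * lam * (2 * Catalan + 5)) * (tail (S n) * / scaled_den (S n))).
    { intros n; pose proof (cf_tail lam (S n) Hpos Hlim) as E.
      pose proof (Hden n); pose proof (fact2_sq_pos (S n)).
      rewrite Hcf in *.
      replace (cf_num cf_a cf_b (S n))
        with ((fact2_sq (S n) * tail (S n) / (2 * lam)
               + 32 * (fact2_sq (S n) * scaled_den (S n))) / (2 * Catalan + 5)).
      - field; repeat split; lra.
      - rewrite <- E; field; split; lra. }
    replace (Finite (32 / (2 * Catalan + 5))) with
      (Finite (32 / (2 * Catalan + 5) + / (2 * lam * (2 * Catalan + 5)) * 0))
      by (f_equal; ring).
    apply is_lim_seq_plus'; [apply is_lim_seq_const|].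
    apply (is_lim_seq_scal_l _ _ 0).
    apply is_lim_seq_le_0 with (fun n => tail 0 * / scaled_den (S n)).
    + intros n; pose proof (tail_bounds lam Hpos Hlim (S n)).
      assert (0 < / scaled_den (S n)) by apply Rinv_0_lt_compat, Hden.
      rewrite Rabs_pos_eq by (apply Rmult_le_pos; lra).
      apply Rmult_le_compat_r; lra.
    + replace 0 with (tail 0 * 0) by ring.
      apply (is_lim_seq_scal_l _ (tail 0) 0).
      apply (is_lim_seq_inv _ p_infty); [|discriminate].
      apply (is_lim_seq_incr_1 scaled_den), scaled_den_lim.
Qed.
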